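(* Let $\mathfrak{g}=\mathfrak{s}(\mathfrak{g})\oplus\mathfrak{c}(\mathfrak{g})$ be a compact Lie algebra, where $\mathfrak{s}(\mathfrak{g})=[\mathfrak{g},\mathfrak{g}]$ is its semisimple part and $\mathfrak{c}(\mathfrak{g})$ its center, let $\mathfrak{h}$ be a Lie subalgebra of $\mathfrak{g}$ with semisimple part $\mathfrak{s}(\mathfrak{h})=[\mathfrak{h},\mathfrak{h}]$, and let $\phi$ be a finite-dimensional faithful and semisimple complex representation of $\mathfrak{g}$. If $\dim(\mathrm{com}[(\phi\otimes\phi)|_{\mathfrak{h}}])=\dim(\mathrm{com}[\phi\otimes\phi])$, then $\mathfrak{s}(\mathfrak{h})=\mathfrak{s}(\mathfrak{g})$.
   Context: Representations are finite-dimensional complex matrix representations; semisimple means completely reducible. $(\phi\otimes\phi)(g)=\phi(g)\otimes\mathbb 1+\mathbb 1\otimes\phi(g)$. $\mathrm{com}[\psi]$ is the space of complex matrices commuting with all $\psi(g)$; $|_{\mathfrak{h}}$ denotes restriction. *)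

(* Defs.v *)
From HB Require Import structures.
From mathcomp Require Import all_boot all_order all_algebra.
From mathcomp Require Import reals.
From mathcomp Require Import complex mxtens.
Set Implicit Arguments. Unset Strict Implicit. Unset Printing Implicit Defensive.
Import Order.TTheory GRing.Theory Num.Theory.
Local Open Scope ring_scope.

Record lie_bracket (K : nzRingType) (V : lmodType K) := LieBracket {
  lbr : V -> V -> V;
  lbr_linl : forall (a : K) (x y z : V), lbr (a *: x + y) z = a *: lbr x z + lbr y z;
  lbr_linr : forall (a : K) (x y z : V), lbr z (a *: x + y) = a *: lbr z x + lbr z y;
  lbr_alt : forall x : V, lbr x x = 0;
  lbr_jacobi : forall x y z : V,
    lbr x (lbr y z) + lbr y (lbr z x) + lbr z (lbr x y) = 0
}.

Section Defs.
Variables (R : realType) (V : vectType R) (L : lie_bracket V).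

Definition compact_lie : Prop :=
  exists B : V -> V -> R,
    [/\ forall (a : R) (x y z : V), B (a *: x + y) z = a * B x z + B y z,
        forall x y : V, B x y = B y x,
        forall x : V, x != 0 -> 0 < B x x &
        forall x y z : V, B (lbr L x y) z + B y (lbr L x z) = 0].

Definition lie_subalgebra (h : {vspace V}) : Prop :=
  forall x y, x \in h -> y \in h -> lbr L x y \in h.

(* The derived algebra [h,h]: the span of all brackets [x,y], x,y in h
   (spanned by the brackets of basis vectors, by bilinearity). *)
Definition derived (h : {vspace V}) : {vspace V} :=
  (\sum_(i < \dim h) \sum_(j < \dim h)
      <[ lbr L (tnth (vbasis h) i) (tnth (vbasis h) j) ]>)%VS.

Definition is_rep (n : nat) (phi : V -> 'M[R[i]]_n) : Prop :=
  (forall (a : R) (x y : V), phi (a *: x + y) = (a%:C)%C *: phi x + phi y) /\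
  (forall x y : V, phi (lbr L x y) = phi x *m phi y - phi y *m phi x).

Definition faithful_rep (n : nat) (phi : V -> 'M[R[i]]_n) : Prop :=
  injective phi.

(* Subspace of C^n (rows of U, viewed as column vectors) stable under all phi x. *)
Definition rep_stable (n : nat) (phi : V -> 'M[R[i]]_n) (U : 'M[R[i]]_n) : Prop :=
  forall x : V, (U *m (phi x)^T <= U)%MS.

Definition semisimple_rep (n : nat) (phi : V -> 'M[R[i]]_n) : Prop :=
  forall U : 'M[R[i]]_n, rep_stable phi U ->
    exists W : 'M[R[i]]_n,
      [/\ rep_stable phi W, (U :&: W == (0 : 'M[R[i]]_n))%MS & (U + W == 1%:M)%MS].

Definition tens_rep (n : nat) (phi : V -> 'M[R[i]]_n) : V -> 'M[R[i]]_(n * n) :=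
  fun x => phi x *t 1%:M + 1%:M *t phi x.

(* com[psi|_h]: complex matrices commuting with psi x for every x in h
   (equivalently, with psi of every basis vector of h, by linearity). *)
Definition com_space (N : nat) (psi : V -> 'M[R[i]]_N) (h : {vspace V})
  : {vspace 'M[R[i]]_N} :=
  (\bigcap_(k < \dim h)
     lker (linfun (fun A : 'M[R[i]]_N =>
        A *m psi (tnth (vbasis h) k) - psi (tnth (vbasis h) k) *m A)))%VS.

End Defs.

(* Main.v *)
Require Import Defs.
From HB Require Import structures.
From mathcomp Require Import all_boot all_order all_algebra.
From mathcomp Require Import reals.
From mathcomp Require Import complex mxtens.
Import Order.TTheory GRing.Theory Num.Theory.
Local Open Scope ring_scope.

(* Equality of dimensions means that every matrix commuting with
   [phi (x) phi] on [h] commutes with it on the whole algebra [g].  Two families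
   of such matrices suffice.  First, [X (x) 1] with [X] in the commutant of
   [phi h]: hence no nonzero element of [g' = [g,g]] centralizes [h].  Second, the
   quadratic Casimir tensor of [h' = [h,h]] for an invariant inner product:
   since [phi] stays injective on the complexification of [g'], this tensor is
   [g]-invariant, so the orthogonal complement [m] of [h'] in [g'] is an ideal
   of [g].  The [m]-component of an element of [h] centralizes [h], hence is
   zero; thus [h] is orthogonal to [m], so [m] centralizes [h], and [m = 0]. *)

(** Stated from bare additivity because [lbr], [B] and [phi] carry no bundled morphism structure;
    [f 0 = 0] follows by cancellation. *)
Lemma raddf_big {U W : zmodType} {f : U -> W} {I : Type} {s : seq I} {F : I -> U} :
  {morph f : x y / x + y} -> f (\sum_(i <- s) F i) = \sum_(i <- s) f (F i).
Proof.
move=> fD; apply: big_morph => //.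
by apply: (addIr (f 0)); rewrite -fD !add0r.
Qed.

Lemma linfun_linearE {K : nzRingType} {U W : vectType K} {f : U -> W} :
  linear f -> linfun f =1 f.
Proof.
move=> flin; pose g : {linear U -> W} := HB.pack f (GRing.isLinear.Build _ _ _ _ f flin).
exact: (lfunE g).
Qed.

(** * Kronecker products of square matrices *)

Section Tensor.
Context {K : fieldType} {n : nat}.
Implicit Types (A B C X Y : 'M[K]_n).

Lemma tensmxDl A B C : (A + B) *t C = A *t C + B *t C.
Proof. by apply/matrixP=> i j; rewrite !mxE mulrDl. Qed.

Lemma tensmxDr A B C : A *t (B + C) = A *t B + A *t C.
Proof. by apply/matrixP=> i j; rewrite !mxE mulrDr. Qed.

Lemma tensmxZl a A B : (a *: A) *t B = a *: (A *t B).
Proof. by apply/matrixP=> i j; rewrite !mxE mulrA. Qed.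

Lemma tensmxZr a A B : A *t (a *: B) = a *: (A *t B).
Proof. by apply/matrixP=> i j; rewrite !mxE mulrCA. Qed.

Lemma tensmxBl A B C : (A - B) *t C = A *t C - B *t C.
Proof. by rewrite -scaleN1r tensmxDl tensmxZl scaleN1r. Qed.

Lemma tensmxBr A B C : A *t (B - C) = A *t B - A *t C.
Proof. by rewrite -scaleN1r tensmxDr tensmxZr scaleN1r. Qed.

Lemma tens1_inj A : A *t (1%:M : 'M_n) = 0 -> A = 0.
Proof.
move=> A0; apply/matrixP=> i j.
(* The second indices agree, so the identity factor contributes 1 and this entry is [A i j]. *)
move/matrixP/(_ (mxtens_index (i, i)) (mxtens_index (j, i))): A0.
by rewrite tensmxE !mxE eqxx mulr1.
Qed.

(** The Leibniz rule for the adjoint action on a pure tensor; both families of commuting matrices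
    are tested with it. *)
Lemma tens_commutator A X Y :
  (A *t 1%:M + 1%:M *t A) *m (X *t Y) - (X *t Y) *m (A *t 1%:M + 1%:M *t A)
  = (A *m X - X *m A) *t Y + X *t (A *m Y - Y *m A).
Proof.
rewrite mulmxDl mulmxDr !tensmx_mul !mul1mx !mulmx1 tensmxBl tensmxBr.
by rewrite opprD addrACA.
Qed.

(* The contraction [F (x) id] of the first tensor factor. *)
Definition tens_slice (F : 'M[K]_n -> K) (M : 'M[K]_(n * n)) : 'M[K]_n :=
  \matrix_(k, l) F (\matrix_(i, j) M (mxtens_index (i, k)) (mxtens_index (j, l))).

Lemma tens_slice_tens (F : 'M[K]_n -> K) A B :
  (forall a X, F (a *: X) = a * F X) -> tens_slice F (A *t B) = F A *: B.
Proof.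
move=> FZ; apply/matrixP=> k l; rewrite !mxE mulrC -FZ; congr F.
by apply/matrixP=> i j; rewrite !mxE !mxtens_indexK /= mulrC.
Qed.

Lemma tens_sliceD (F : 'M[K]_n -> K) : {morph F : X Y / X + Y} ->
  {morph tens_slice F : M N / M + N}.
Proof.
move=> FD M N; apply/matrixP=> k l; rewrite !mxE -FD; congr F.
by apply/matrixP=> i j; rewrite !mxE.
Qed.

End Tensor.

(** [com_space] tests only basis vectors of [h]; real linearity of [psi] extends the commutation to
    all of [h]. *)
Lemma mem_com_space {R : realType} {V : vectType R} {N : nat}
    {psi : V -> 'M[R[i]]_N} {h : {vspace V}} {A : 'M[R[i]]_N} :
  (forall (a : R) x y, psi (a *: x + y) = (a%:C)%C *: psi x + psi y) ->
  A \in com_space psi h <-> forall x, x \in h -> A *m psi x = psi x *m A.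
Proof.
move=> psi_lin.
have psiD : {morph psi : x y / x + y}.
  by move=> x y; have := psi_lin 1 x y; rewrite !scale1r.
have psi0 : psi 0 = 0 by apply: (addIr (psi 0)); rewrite -psiD !add0r.
have psiZ a x : psi (a *: x) = (a%:C)%C *: psi x.
  by have := psi_lin a x 0; rewrite psi0 !addr0.
have com_lin x : linear (fun M : 'M[R[i]]_N => M *m psi x - psi x *m M).
  move=> a M M'; rewrite mulmxDl mulmxDr -scalemxAl -scalemxAr scalerBr.
  by rewrite opprD addrACA.
split=> [Acom x xh | Acom].
  rewrite (coord_vbasis xh) (raddf_big psiD) mulmx_sumr mulmx_suml.
  apply: eq_bigr => k _; rewrite psiZ -scalemxAr -scalemxAl; congr (_ *: _).
  have /subv_bigcapP/(_ k isT) : (<[A]> <= com_space psi h)%VS by rewrite -memvE.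
  rewrite -memvE memv_ker linfun_linearE; last exact: com_lin.
  by rewrite subr_eq0 -tnth_nth => /eqP.
rewrite memvE; apply/subv_bigcapP => k _.
rewrite -memvE memv_ker linfun_linearE; last exact: com_lin.
by rewrite Acom ?subrr // vbasis_mem // mem_tnth.
Qed.

(** * Lie brackets and derived algebras *)

Section LieBracket.
Context {R : realType} {V : vectType R} (L : lie_bracket V).
Local Notation "<| x , y |>" := (lbr L x y) (at level 0).

Lemma lbrDl z : {morph (fun x => <| x, z |>) : x y / x + y}.
Proof. by move=> x y; have := lbr_linl L 1 x y z; rewrite !scale1r. Qed.

Lemma lbrDr z : {morph (fun x => <| z, x |>) : x y / x + y}.
Proof. by move=> x y; have := lbr_linr L 1 x y z; rewrite !scale1r. Qed.

Lemma lbrC x y : <| x, y |> = - <| y, x |>.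
Proof.
apply/eqP; rewrite -addr_eq0; have := lbr_alt L (x + y).
by rewrite lbrDl !lbrDr !lbr_alt add0r addr0 => ->.
Qed.

Lemma lbr0 x : <| x, 0 |> = 0.
Proof. by apply: (addIr <| x, 0 |>); rewrite -lbrDr !add0r. Qed.

Lemma lbrZr a x y : <| x, a *: y |> = a *: <| x, y |>.
Proof. by have := lbr_linr L a y 0 x; rewrite !addr0 lbr0 addr0. Qed.

Lemma lbrZl a x y : <| a *: x, y |> = a *: <| x, y |>.
Proof. by rewrite lbrC lbrZr -scalerN -lbrC. Qed.

Lemma mem_derived (h : {vspace V}) x y :
  x \in h -> y \in h -> <| x, y |> \in derived L h.
Proof.
move=> xh yh; rewrite (coord_vbasis xh) (coord_vbasis yh).
rewrite (raddf_big (lbrDl _)); apply: rpred_sum => i _.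
rewrite (raddf_big (lbrDr _)); apply: rpred_sum => j _.
rewrite lbrZl lbrZr; do 2!apply: rpredZ.
rewrite -!tnth_nth; apply: subvP (memv_line _).
by apply: (sumv_sup i) => //; apply: (sumv_sup j).
Qed.

Lemma derived_ind (h : {vspace V}) (P : V -> Prop) :
  P 0 -> (forall a x y, P x -> P y -> P (a *: x + y)) ->
  (forall x y, x \in h -> y \in h -> P <| x, y |>) ->
  forall z, z \in derived L h -> P z.
Proof.
move=> P0 Plin Pbr z /memv_sumP[u uP ->].
have PD x y : P x -> P y -> P (x + y) by rewrite -{2}[x]scale1r; apply: Plin.
apply: big_ind => // i _; have /memv_sumP[v vP ->] := uP i isT.
apply: big_ind => // j _; have /vlineP[k ->] := vP j isT.
by rewrite -[_ *: _]addr0; apply: Plin => //; apply: Pbr; apply: vbasis_mem;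
  apply: mem_tnth.
Qed.

Lemma derivedS (h k : {vspace V}) : (h <= k)%VS -> (derived L h <= derived L k)%VS.
Proof.
move=> /subvP hk; apply/subvP; apply: derived_ind => [|a x y|x y xh yh].
- exact: mem0v.
- by move=> *; rewrite rpredD ?rpredZ.
- by apply: mem_derived; apply: hk.
Qed.

Lemma derived_sub (h : {vspace V}) : lie_subalgebra L h -> (derived L h <= h)%VS.
Proof.
move=> hL; apply/subvP; apply: derived_ind => [|a x y|x y xh yh].
- exact: mem0v.
- by move=> *; rewrite rpredD ?rpredZ.
- exact: hL.
Qed.

(** * Geometry of an invariant inner product *)

Section InvariantForm.
Variable B : V -> V -> R.
Hypothesis B_lin : forall (a : R) x y z, B (a *: x + y) z = a * B x z + B y z.
Hypothesis B_sym : forall x y, B x y = B y x.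
Hypothesis B_pos : forall x, x != 0 -> 0 < B x x.
Hypothesis B_inv : forall x y z, B <| x, y |> z + B y <| x, z |> = 0.

Lemma formDl z : {morph (fun x => B x z) : x y / x + y}.
Proof. by move=> x y; have := B_lin 1 x y z; rewrite scale1r mul1r. Qed.

Lemma formDr z : {morph B z : x y / x + y}.
Proof. by move=> x y; rewrite !(B_sym z) formDl. Qed.

Lemma form0l z : B 0 z = 0.
Proof. by apply: (addIr (B 0 z)); rewrite -formDl !add0r. Qed.

Lemma formZl a x z : B (a *: x) z = a * B x z.
Proof. by have := B_lin a x 0 z; rewrite !addr0 form0l addr0. Qed.

Lemma formZr a x z : B x (a *: z) = a * B x z.
Proof. by rewrite B_sym formZl B_sym. Qed.

Lemma formNl x z : B (- x) z = - B x z.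
Proof. by rewrite -scaleN1r formZl mulN1r. Qed.

Lemma formNr x z : B x (- z) = - B x z.
Proof. by rewrite B_sym formNl B_sym. Qed.

Lemma form_eq0 x : B x x = 0 -> x = 0.
Proof. by move=> B0; apply/eqP/negPn/negP=> /B_pos; rewrite B0 ltxx. Qed.

Lemma form_ge0 x : 0 <= B x x.
Proof. by have [->|/B_pos/ltW//] := eqVneq x 0; rewrite form0l. Qed.

Lemma form_invl x y z : B <| x, y |> z = - B y <| x, z |>.
Proof. by apply/eqP; rewrite -addr_eq0 B_inv. Qed.

Lemma form_assoc x y z : B <| x, y |> z = B x <| y, z |>.
Proof. by rewrite lbrC formNl form_invl opprK. Qed.

(** Gram-Schmidt: normalize a nonzero vector of [U], then recurse on its orthogonal complement in
    [U]. *)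
Lemma parseval_frame (U : {vspace V}) : exists s : seq V,
  {subset s <= U} /\ forall z, z \in U -> z = \sum_(u <- s) B z u *: u.
Proof.
have [m] := ubnP (\dim U); elim: m U => // m IHm U /ltnSE dimU.
have [->|U_neq0] := eqVneq U 0%VS.
  by exists [::]; split=> // z; rewrite memv0 big_nil => /eqP.
pose v := vpick U.
have v_neq0 : v != 0 by rewrite vpick0.
pose u := (Num.sqrt (B v v))^-1 *: v.
have Uu : u \in U by rewrite rpredZ ?memv_pick.
have uu : B u u = 1.
  rewrite formZl formZr mulrA -expr2 exprVn sqr_sqrtr ?form_ge0 //.
  by rewrite mulVf // gt_eqF // B_pos.
pose f : V -> R^o := fun x => B x u.
have f_lin : linear f by move=> a x y; rewrite /f B_lin.
pose W := (U :&: lker (linfun f))%VS.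
have memW x : (x \in W) = (x \in U) && (B x u == 0).
  by rewrite memv_cap memv_ker (linfun_linearE f_lin).
have dimW : (\dim W < m)%N.
  apply: leq_trans dimU; rewrite ltnNge; apply/negP => UW.
  have /eqP eqWU : W == U by rewrite eqEdim capvSl.
  by have := memW u; rewrite eqWU Uu uu oner_eq0.
have [s [sW sP]] := IHm _ dimW.
exists (u :: s); split=> [x|z zU].
  by rewrite inE => /predU1P[-> //|/sW]; rewrite memW => /andP[].
rewrite big_cons; apply/eqP; rewrite addrC -subr_eq; apply/eqP.
(* The remainder lies in [W]; its coefficients are those of [z] because the frame of [W] is
   orthogonal to [u]. *)
rewrite {1}(sP (z - B z u *: u)) ?memW.
  rewrite big_seq [RHS]big_seq; apply: eq_bigr => x /sW.
  rewrite memW => /andP[_ /eqP Bxu].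
  by rewrite formDl formNl formZl (B_sym u) Bxu mulr0 subr0.
apply/andP; split; first by apply: rpredB => //; apply: rpredZ.
by rewrite formDl formNl formZl uu mulr1 subrr.
Qed.

Lemma orth_proj (U : {vspace V}) x :
  exists2 p, p \in U & forall w, w \in U -> B p w = B x w.
Proof.
have [s [sU sP]] := parseval_frame U.
exists (\sum_(u <- s) B x u *: u).
  by rewrite big_seq; apply: rpred_sum => u /sU; apply: rpredZ.
move=> w /sP wE; rewrite (raddf_big (formDl _)) [in RHS]wE (raddf_big (formDr _)).
by apply: eq_bigr => u _; rewrite formZl formZr (B_sym w) mulrC.
Qed.

(** By invariance a central element is orthogonal to every bracket; lying in the derived algebra, it
    is orthogonal to itself. *)
Lemma derived_center x :
  x \in derived L fullv -> (forall y, <| y, x |> = 0) -> x = 0.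
Proof.
move=> xs xc; suff Bx w : w \in derived L fullv -> B w x = 0.
  by apply: form_eq0; apply: Bx.
move: w; apply: derived_ind => [|a y z By Bz|y z _ _].
- exact: form0l.
- by rewrite B_lin By Bz mulr0 addr0.
- by rewrite form_invl xc B_sym form0l oppr0.
Qed.

(** * Faithfulness on the complexified derived algebra *)

Section Representation.
Context {n : nat} (phi : V -> 'M[R[i]]_n).
Hypothesis phi_rep : is_rep L phi.
Hypothesis phi_inj : faithful_rep phi.

Lemma repD : {morph phi : x y / x + y}.
Proof. by move=> x y; have := phi_rep.1 1 x y; rewrite !scale1r. Qed.

Lemma rep0 : phi 0 = 0.
Proof. by apply: (addIr (phi 0)); rewrite -repD !add0r. Qed.

Lemma repZ a x : phi (a *: x) = (a%:C)%C *: phi x.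
Proof. by have := phi_rep.1 a x 0; rewrite rep0 !addr0. Qed.

Lemma repN x : phi (- x) = - phi x.
Proof. by apply: (addrI (phi x)); rewrite -repD !subrr rep0. Qed.

Lemma rep_eq0 x : phi x = 0 -> x = 0.
Proof. by rewrite -rep0 => /phi_inj. Qed.

Lemma tens_rep_linear (a : R) x y :
  tens_rep phi (a *: x + y) = (a%:C)%C *: tens_rep phi x + tens_rep phi y.
Proof.
rewrite /tens_rep phi_rep.1 tensmxDl tensmxDr tensmxZl tensmxZr scalerDr.
by rewrite addrACA.
Qed.

(* Formally [ad b] is ['i] times [ad a], whence [(ad b)^2 = - (ad a)^2], while both
   squares are negative semidefinite for the invariant form. *)
Lemma complex_line_central a b :
  phi b = 'i%C *: phi a -> forall v, <| a, v |> = 0.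
Proof.
move=> ba v.
have bav w : phi <| b, w |> = 'i%C *: phi <| a, w |>.
  by rewrite !phi_rep.2 ba -scalemxAl -scalemxAr -scalerBr.
have bb : <| b, <| b, v |> |> = - <| a, <| a, v |> |>.
  apply: phi_inj; rewrite repN bav (phi_rep.2 a <| b, v |>) bav.
  rewrite -scalemxAl -scalemxAr -scalerBr scalerA -phi_rep.2.
  by rewrite -expr2 sqr_i scaleN1r.
have : B <| b, v |> <| b, v |> = - B <| a, v |> <| a, v |>.
  by rewrite !form_invl bb formNr.
move=> Bba; apply: form_eq0; apply/eqP; rewrite eq_le form_ge0 andbT.
by rewrite -oppr_ge0 -Bba form_ge0.
Qed.

(** The relation reads [phi (- a) = 'i *: phi b], so [b] is central by [complex_line_central], hence
    zero in the derived algebra. *)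
Lemma complex_comb_derived a b : a \in derived L fullv -> b \in derived L fullv ->
  phi a + 'i%C *: phi b = 0 -> a = 0 /\ b = 0.
Proof.
move=> ag bg ab0.
have /complex_line_central bc : phi (- a) = 'i%C *: phi b.
  by apply/eqP; rewrite repN eq_sym -addr_eq0 addrC ab0.
have b0 : b = 0.
  by apply: derived_center => // y; rewrite lbrC bc oppr0.
split=> //; apply: rep_eq0.
by rewrite b0 rep0 scaler0 addr0 in ab0.
Qed.

Lemma rep_basis_free :
  free (map_tuple phi (vbasis (derived L fullv))).
Proof.
set U := derived L fullv; apply/freeP => k k0.
(* Splitting the complex coefficients turns a linear relation into [phi a + 'i *: phi b = 0] with
   [a], [b] in the derived algebra. *)
pose re_part := \sum_(i < \dim U) complex.Re (k i) *: (vbasis U)`_i.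
pose im_part := \sum_(i < \dim U) complex.Im (k i) *: (vbasis U)`_i.
have mem_basis (i : 'I_(\dim U)) : (vbasis U)`_i \in U.
  by apply: vbasis_mem; apply: mem_nth; rewrite size_tuple.
have [re0 im0] : re_part = 0 /\ im_part = 0.
  apply: complex_comb_derived; try by apply: rpred_sum => i _; apply: rpredZ.
  rewrite !(raddf_big repD) scaler_sumr -big_split /= -[RHS]k0.
  apply: eq_bigr => i _; rewrite !repZ scalerA -scalerDl.
  rewrite (nth_map 0) ?size_tuple //; congr (_ *: _).
  by case: (k i) => r s /=; simpc.
have freeU := basis_free (vbasisP U).
move=> i; have := freeP freeU _ re0 i; have := freeP freeU _ im0 i.
by case: (k i) => r s /= -> ->.
Qed.

(** The images of a real basis are free over the complex numbers, so their coordinate functionals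
    extend the real form [B _ z] to a complex linear functional on matrices. *)
Lemma extend_form z : exists F : 'M[R[i]]_n -> R[i],
  [/\ {morph F : X Y / X + Y}, forall a X, F (a *: X) = a * F X &
      forall x, x \in derived L fullv -> F (phi x) = ((B x z)%:C)%C].
Proof.
set U := derived L fullv.
pose X := map_tuple phi (vbasis U).
exists (fun M => \sum_(k < \dim U) ((B (vbasis U)`_k z)%:C)%C * coord X k M).
split=> [M N|a M|x xU].
- by rewrite -big_split /=; apply: eq_bigr => k _; rewrite linearD mulrDr.
- by rewrite mulr_sumr; apply: eq_bigr => k _; rewrite linearZ mulrCA.
have -> : phi x = \sum_(i < \dim U) ((coord (vbasis U) i x)%:C)%C *: X`_i.
  rewrite [in LHS](coord_vbasis xU) (raddf_big repD); apply: eq_bigr => i _.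
  by rewrite repZ (nth_map 0) ?size_tuple.
rewrite [in RHS](coord_vbasis xU) (raddf_big (formDl _)) rmorph_sum /=.
apply: eq_bigr => k _; rewrite coord_sum_free ?rep_basis_free //.
by rewrite formZl rmorphM mulrC.
Qed.

(** * Consequences of equal commutant dimensions *)

Section Commutant.
Variable h : {vspace V}.
Hypothesis hL : lie_subalgebra L h.
Hypothesis com_dim :
  \dim (com_space (tens_rep phi) h) = \dim (com_space (tens_rep phi) fullv).

Lemma com_space_full A : A \in com_space (tens_rep phi) h ->
  A \in com_space (tens_rep phi) fullv.
Proof.
have sub : (com_space (tens_rep phi) fullv <= com_space (tens_rep phi) h)%VS.
  apply/subvP => M /(mem_com_space tens_rep_linear) Mcom.
  by apply/(mem_com_space tens_rep_linear) => x _; apply: Mcom; apply: memvf.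
have /eqP-> // : com_space (tens_rep phi) fullv == com_space (tens_rep phi) h.
by rewrite eqEdim sub com_dim leqnn.
Qed.

Lemma tens_commute_full A :
  (forall x, x \in h -> A *m tens_rep phi x = tens_rep phi x *m A) ->
  forall y, A *m tens_rep phi y = tens_rep phi y *m A.
Proof.
move=> /(mem_com_space tens_rep_linear)/com_space_full.
by move=> /(mem_com_space tens_rep_linear) AP y; apply: AP; apply: memvf.
Qed.

(** The commutator of [tens_rep phi x] with [phi z *t 1%:M] is [phi <| x, z |> *t 1%:M]. It vanishes
    on [h], hence everywhere, so [z] is central. *)
Lemma centralizer_derived0 z : z \in derived L fullv ->
  (forall x, x \in h -> <| x, z |> = 0) -> z = 0.
Proof.
move=> zg zh; apply: derived_center => // y.
have commE x : tens_rep phi x *m (phi z *t 1%:M) - (phi z *t 1%:M) *m tens_rep phi x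
    = phi <| x, z |> *t 1%:M.
  by rewrite tens_commutator mulmx1 mul1mx subrr tensmx0 addr0 -phi_rep.2.
have := @tens_commute_full (phi z *t 1%:M) _ y.
move=> zy; apply: rep_eq0; apply: tens1_inj; rewrite -commE zy ?subrr // => x xh.
by apply/eqP; rewrite eq_sym -subr_eq0 commE zh // rep0 tens0mx.
Qed.

(* [sum_u u (x) u] over a Parseval frame of [h' = derived L h] is [h]-invariant,
   so [sum_u phi u (x) phi u] commutes with all of [tens_rep phi]; contracting
   its first factor with [z] shows that the projection of [<| y, z |>] to [h']
   vanishes. *)
Lemma orth_derived_stable y z :
  (forall w, w \in derived L h -> B w z = 0) ->
  forall w, w \in derived L h -> B w <| y, z |> = 0.
Proof.
move=> zh.
have [s [sh sP]] := parseval_frame (derived L h).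
have derhh := subvP (derived_sub _ hL).
have derhg : {subset derived L h <= derived L fullv}.
  by apply/subvP/derivedS/subvf.
pose omega := \sum_(u <- s) phi u *t phi u.
have commE x : tens_rep phi x *m omega - omega *m tens_rep phi x
    = \sum_(u <- s) (phi <| x, u |> *t phi u + phi u *t phi <| x, u |>).
  rewrite mulmx_sumr mulmx_suml -sumrB; apply: eq_bigr => u _.
  by rewrite tens_commutator -!phi_rep.2.
have omega_comm : tens_rep phi y *m omega = omega *m tens_rep phi y.
  symmetry; apply: tens_commute_full => x xh.
  apply/eqP; rewrite eq_sym -subr_eq0 commE big_split /=; apply/eqP.
  have adE u : u \in s -> phi <| x, u |> = \sum_(v <- s) ((B <| x, u |> v)%:C)%C *: phi v.
    move=> us; rewrite [in LHS](sP <| x, u |>).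
      by rewrite (raddf_big repD); apply: eq_bigr => v _; rewrite repZ.
    by apply: mem_derived => //; apply/derhh/sh.
  have -> : \sum_(u <- s) phi <| x, u |> *t phi u =
      \sum_(u <- s) \sum_(v <- s) ((B <| x, u |> v)%:C)%C *: (phi v *t phi u).
    rewrite big_seq [RHS]big_seq; apply: eq_bigr => u us; rewrite (adE _ us).
    rewrite (raddf_big (fun a b => tensmxDl a b _)).
    by apply: eq_bigr => v _; rewrite tensmxZl.
  have -> : \sum_(u <- s) phi u *t phi <| x, u |> =
      \sum_(v <- s) \sum_(u <- s) ((B <| x, u |> v)%:C)%C *: (phi u *t phi v).
    rewrite exchange_big /= big_seq [RHS]big_seq; apply: eq_bigr => u us.
    rewrite (adE _ us) (raddf_big (tensmxDr _)).
    by apply: eq_bigr => v _; rewrite tensmxZr.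
  (* The two coefficients of [phi v *t phi u] are [B <| x, u |> v] and [B <| x, v |> u], opposite by
     invariance. *)
  rewrite -big_split /=; apply: big1 => u _.
  rewrite -big_split /=; apply: big1 => v _.
  rewrite -scalerDl -rmorphD /= form_invl [B <| x, v |> u]B_sym addNr.
  by rewrite rmorph0 scale0r.
have [F [FD FZ FE]] := extend_form z.
(* Contraction by [F] turns the vanishing commutator into the sum over [u] of [B <| y, u |> z] times
   [phi u] plus [B u z] times [phi <| y, u |>]. The second term is zero by [zh], and the first is
   rewritten by invariance. *)
have proj0 : \sum_(u <- s) B u <| y, z |> *: u = 0.
  apply: rep_eq0; have /(congr1 (tens_slice F)) := commE y.
  have slice0 : tens_slice F 0 = 0.
    by apply: (addIr (tens_slice F 0)); rewrite -tens_sliceD // !add0r.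
  rewrite omega_comm subrr slice0 (raddf_big (tens_sliceD _ FD)) => /esym sum0.
  apply: oppr_inj; rewrite oppr0 -[RHS]sum0 -repN -sumrN (raddf_big repD).
  rewrite big_seq [RHS]big_seq; apply: eq_bigr => u /sh uh.
  rewrite (tens_sliceD _ FD) !tens_slice_tens // !FE ?mem_derived ?memvf ?derhg //.
  by rewrite (zh u uh) rmorph0 scale0r addr0 repN repZ form_invl rmorphN scaleNr.
move=> w wh; apply: (@etrans _ _ (B w (\sum_(u <- s) B u <| y, z |> *: u))).
  rewrite [in LHS](sP w wh) (raddf_big (formDl _)) (raddf_big (formDr _)).
  by apply: eq_bigr => u _; rewrite formZl formZr mulrC.
by rewrite proj0 B_sym form0l.
Qed.

Lemma derived_full : derived L h = derived L fullv.
Proof.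
have derhg := derivedS _ _ (subvf h).
(* The orthogonal complement of [derived L h] in the derived algebra, which [m_stable] shows to be
   an ideal. *)
pose in_m z := z \in derived L fullv /\ forall w, w \in derived L h -> B w z = 0.
have m_stable y z : in_m z -> in_m <| y, z |>.
  move=> [zg zh]; split; first by rewrite mem_derived ?memvf.
  exact: orth_derived_stable.
(* Projection to this complement is the difference of the projections to the two derived
   algebras. *)
have m_proj x : exists2 p, in_m p & forall w, in_m w -> B p w = B x w.
  have [a ag aP] := orth_proj (derived L fullv) x.
  have [b bh bP] := orth_proj (derived L h) x.
  exists (a - b) => [|w [wg wh]]; last by rewrite formDl formNl aP // (wh b bh) subr0.
  split=> [|w wh]; first by rewrite rpredB // (subvP derhg).
  by rewrite B_sym formDl formNl aP ?bP ?subrr // (subvP derhg).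
have h_orth_m x : x \in h -> forall w, in_m w -> B x w = 0.
  move=> xh; have [p pm pP] := m_proj x.
  suff p0 : p = 0 by move=> w wm; rewrite -pP // p0 form0l.
  apply: centralizer_derived0 => [|y yh]; first exact: pm.1.
  have ypm := m_stable y p pm.
  (* Moving [y] across the form, replacing [p] by [x], and moving [y] back gives
     [B <| y, x |> <| y, p |>], which pairs [derived L h] with its complement. *)
  apply: form_eq0; rewrite {1}form_invl pP; last exact: m_stable.
  rewrite -form_invl; apply: ypm.2; exact: mem_derived.
have m0 z : in_m z -> z = 0.
  move=> zm; apply: centralizer_derived0 => [|x xh]; first exact: zm.1.
  (* The squared norm of [<| x, z |>] equals [B x <| z, <| x, z |> |>], a pairing of [h] with the
     complement. *)
  apply: form_eq0; rewrite form_assoc h_orth_m //.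
  exact/m_stable/m_stable.
apply/eqP; rewrite eqEsubv derhg; apply/subvP => z zg /=.
(* Subtracting the projection of [z] to [derived L h] leaves an element of the complement, hence
   zero. *)
have [b bh bP] := orth_proj (derived L h) z.
have /m0/eqP : in_m (z - b).
  split=> [|w wh]; first by rewrite rpredB // (subvP derhg).
  by rewrite B_sym formDl formNl bP ?subrr.
by rewrite subr_eq0 => /eqP->.
Qed.

End Commutant.
End Representation.
End InvariantForm.
End LieBracket.

Theorem theorem9 (R : realType) (V : vectType R) (L : lie_bracket V)
  (h : {vspace V}) (n : nat) (phi : V -> 'M[R[i]]_n) :
  compact_lie L ->
  lie_subalgebra L h ->
  is_rep L phi -> faithful_rep phi -> semisimple_rep phi ->
  \dim (com_space (tens_rep phi) h) = \dim (com_space (tens_rep phi) fullv) ->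
  derived L h = derived L fullv.
Proof.
case=> B [B_lin B_sym B_pos B_inv] hL phi_rep phi_inj _ com_dim.
exact: (derived_full L B B_lin B_sym B_pos B_inv phi phi_rep phi_inj h hL com_dim).
Qed.
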